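(* Let $C$ be a Cantor set with a regular ultrametric $d$. For $x,y\in C$ put $$\rho(x,y):=\sup\Big\{|f(x)-f(y)| \;:\; f\in\mathcal{C}_{\mathrm{Lip}}(C),\ \sup_{\tau\in\Upsilon(C)}\|[D,\pi_{\tau}(f)]\|\le 1\Big\}.$$ Then $\rho(x,y)=d(x,y)$ for all $x,y\in C$.
   Context: A Cantor set is a (nonempty) totally disconnected compact metrizable space without isolated points. A metric $d$ on $C$ is regular if it induces the topology of $C$, and it is an ultrametric if $d(x,y)\le\max\{d(x,z),d(z,y)\}$ for all $x,y,z$. Let $\mathcal{V}$ be the vertex set of the reduced weighted rooted tree (Michon tree) of $(C,d)$: the vertices correspond to the distinct subsets of $C$ of the form $\{y: d(x,y)<\epsilon\}$ ($x\in C$, $\epsilon>0$); the root is $C$; the children of a vertex are the maximal vertices strictly contained in it. For $v\in\mathcal V$, $[v]\subset C$ denotes the corresponding subset; it is clopen with diameter $\mathrm{diam}[v]>0$, and $\mathcal V$ is countable. A choice function is a map $\tau:\mathcal V\to C\times C$, $\tau(v)=(\tau_+(v),\tau_-(v))$, with $\tau_\pm(v)\in[v]$ and $d(\tau_+(v),\tau_-(v))=\mathrm{diam}[v]$ for all $v$. $\Upsilon(C)$ is the set of choice functions. $\mathcal{C}_{\mathrm{Lip}}(C)$ is the algebra of complex-valued Lipschitz functions on $(C,d)$. Let $\mathcal H=\ell^2(\mathcal V)\otimes\mathbb C^2$, viewed as square-summable functions $\psi:\mathcal V\to\mathbb C^2$. Let $D$ be the self-adjoint operator $(D\psi)(v)=(\mathrm{diam}[v])^{-1}\sigma_1\psi(v)$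 (with its natural maximal domain), where $\sigma_1=\begin{pmatrix}0&1\\1&0\end{pmatrix}$, and for $\tau\in\Upsilon(C)$ let $(\pi_\tau(f)\psi)(v)=\mathrm{diag}\{f(\tau_+(v)),f(\tau_-(v))\}\,\psi(v)$. The norm $\|[D,\pi_\tau(f)]\|$ is the operator norm of (the bounded extension of) the commutator. *)

(* Defs.v *)
(* MathComp-Analysis, with complex scalars R[i] from mathcomp-real-closed. *)
From HB Require Import structures.
From mathcomp Require Export all_boot all_order all_algebra.
From mathcomp Require Export complex.
From mathcomp Require Export all_classical all_reals all_analysis.
Set Implicit Arguments.
Unset Strict Implicit.
Unset Printing Implicit Defensive.
Import Order.TTheory GRing.Theory Num.Theory.
Import Normc.

Local Open Scope classical_set_scope.
Local Open Scope ring_scope.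
Local Open Scope complex_scope.

Section Metrics.
Context {R : realType} {C : topologicalType}.
Implicit Type d : C -> C -> R.

Definition is_metric d :=
  [/\ forall x y, 0 <= d x y,
      forall x y, d x y = 0 <-> x = y,
      forall x y, d x y = d y x
    & forall x y z, d x y <= d x z + d z y].

Definition dball d (x : C) (e : R) : set C := [set y | d x y < e].

(* [d] induces the given topology of [C]. *)
Definition regular d := forall (x : C) (A : set C),
  nbhs x A <-> exists2 e, 0 < e & dball d x e `<=` A.

Definition ultrametric d := forall x y z, d x y <= Num.max (d x z) (d z y).

Definition diam d (A : set C) : R := sup [set d p.1 p.2 | p in A `*` A].

End Metrics.

Definition cantor_set (R : realType) (C : topologicalType) :=
  [/\ [set: C] !=set0,
      totally_disconnected [set: C],
      compact [set: C],
      exists d : C -> C -> R, is_metric d /\ regular d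
    & isolated [set: C] = set0].

Section Michon.
Context {R : realType} {C : topologicalType}.
Variable d : C -> C -> R.

Definition vertices : set (set C) :=
  [set A | exists x e, 0 < e /\ A = dball d x e].

(* A vertex [v] is identified with the subset [v] of [C], which is [\val v]. *)
Definition vertex := set_type vertices.

Definition choice_functions : set (vertex -> C * C) :=
  [set tau | forall v : vertex,
     [/\ \val v (tau v).1, \val v (tau v).2
       & d (tau v).1 (tau v).2 = diam d (\val v)]].

Definition lipschitz_functions : set (C -> R[i]) :=
  [set f | exists k : R, forall x y, normc (f x - f y) <= k * d x y].

End Michon.

Arguments choice_functions {R C} d _.
Arguments lipschitz_functions {R C} d _.

Section Operators.
Context {R : realType} {V : choiceType}.

Definition l2norm (psi : V -> 'cV[R[i]]_2) : \bar R :=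
  sqrte (\esum_(v in [set: V]) (\sum_(i < 2) normc (psi v i 0) ^+ 2)%:E)%E.

(* The Hilbert space l^2(V) (x) C^2. *)
Definition l2 : set (V -> 'cV[R[i]]_2) := [set psi | (l2norm psi < +oo)%E].

(* A possibly unbounded operator on [l2]; [op_fun] is only meaningful on
   [op_dom]. *)
Record operator := Operator {
  op_dom : set (V -> 'cV[R[i]]_2) ;
  op_fun : (V -> 'cV[R[i]]_2) -> (V -> 'cV[R[i]]_2) }.

(* Fibrewise multiplication by a matrix-valued function, on its maximal domain,
   which is all of [l2] when [M] is bounded. *)
Definition mult_op (M : V -> 'M[R[i]]_2) : operator :=
  let T psi := fun v => M v *m psi v in
  Operator (l2 `&` T @^-1` l2) T.

Definition commutator (A B : operator) : operator :=
  Operator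
    (op_dom B `&` op_fun B @^-1` op_dom A
       `&` (op_dom A `&` op_fun A @^-1` op_dom B))
    (fun psi => op_fun A (op_fun B psi) \- op_fun B (op_fun A psi)).

(* Norm of the operator on its domain, [+oo] if it is unbounded; for a bounded
   densely defined operator this is the norm of its bounded extension. *)
Definition opnorm (T : operator) : \bar R :=
  ereal_sup [set l2norm (op_fun T psi) |
    psi in op_dom T `&` [set psi | (l2norm psi <= 1)%E]].

End Operators.

Section SpectralTriple.
Context {R : realType} {C : topologicalType}.
Variable d : C -> C -> R.

Definition sigma1 : 'M[R[i]]_2 := \matrix_(i < 2, j < 2) (i != j)%:R.

Definition Dirac : operator :=
  mult_op (fun v : vertex d => ((diam d (\val v))^-1)%:C *: sigma1).

Definition pi_rep (tau : vertex d -> C * C) (f : C -> R[i]) : operator :=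
  mult_op (fun v : vertex d => diag_mx
    (\row_(i < 2) if i == 0 then f (tau v).1 else f (tau v).2)).

Definition spectral_dist (x y : C) : \bar R :=
  ereal_sup [set (normc (f x - f y))%:E |
    f in lipschitz_functions d `&`
      [set f | (ereal_sup [set opnorm (commutator Dirac (pi_rep tau f)) |
                  tau in choice_functions d] <= 1)%E]].

End SpectralTriple.

(* Main.v *)
Require Import Defs.
From mathcomp Require Import ring lra.
Import Order.TTheory GRing.Theory Num.Theory Normc.
Import numFieldNormedType.Exports.
Local Open Scope classical_set_scope.
Local Open Scope complex_scope.
Local Open Scope ring_scope.

(** The commutator of [D] with [pi_tau f] acts separately on each fibre over a
    vertex [v], as
      [[0, -s], [s, 0]]  with  s = (f (tau_+ v) - f (tau_- v)) / diam v,
    which multiplies norms by |s|.  Hence the norm of the commutator is the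
    supremum over [v] of |s| ([opnorm_commutator_le1] and
    [le_opnorm_commutator]), and the two inequalities follow.

    The spectral distance is at least [d x y]: the function [d x] has slopes at
    most 1 because [diam v] is the distance from [tau_+ v] to [tau_- v], so it
    is admissible, and it separates [x] from [y] by exactly [d x y].

    It is at most [d x y]: the closed ball of radius [d x y] around [x] is a
    vertex [v] ([closed_ball_vertex]), and by the ultrametric inequality the
    pair [(x, y)] realizes its diameter.  So some choice function takes the
    value [(x, y)] at [v] ([choice_function_through]), and for that choice
    function the bound on the commutator, read at [v] alone, is
    |f x - f y| <= d x y.

    Compactness enters in that closed balls are vertices, since distances from
    [x] have no accumulation point from above at a positive value, and in that
    diameters of vertices are attained, so that choice functions exist. *)

Section UltrametricBalls.
Context {R : realType} {C : topologicalType} (d : C -> C -> R).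
Hypotheses (hmetric : is_metric d) (hregular : regular d).

Lemma dist_lipschitz (x a b : C) : `|d x a - d x b| <= d a b.
Proof.
have [_ _ dC dT] := hmetric.
have := dT x a b; have := dT x b a; rewrite (dC b a) ler_norml => *.
by apply/andP; split; lra.
Qed.

Lemma dist_continuous (x : C) : continuous (d x).
Proof.
move=> z; apply/cvgrPdist_lt => e e0.
apply/hregular; exists e => // w; rewrite /dball /=.
exact/le_lt_trans/dist_lipschitz.
Qed.

Lemma diam_attained (A : set C) (p q : C) : A p -> A q ->
  (forall a b, A a -> A b -> d a b <= d p q) -> diam d A = d p q.
Proof.
move=> Ap Aq dle; apply/eqP; rewrite eq_le; apply/andP; split.
  apply: ge_sup; first by exists (d p q), (p, q).
  by move=> _ [[a b] [/= Aa Ab] <-]; exact: dle.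
apply: ub_le_sup; last by exists (p, q).
by exists (d p q) => _ [[a b] [/= Aa Ab] <-]; exact: dle.
Qed.

Hypothesis hultra : ultrametric d.

(** A point outside a ball is the centre of a ball of the same radius that
    misses it, because two ultrametric balls of equal radius are equal or
    disjoint. *)
Lemma dball_closed (x : C) (e : R) : closed (dball d x e).
Proof.
have [_ _ dC _] := hmetric.
have [e0|e0] := ltP 0 e; last first.
  rewrite (_ : dball d x e = set0); first exact: closed0.
  apply/seteqP; split=> // z; rewrite /dball /= => dxz.
  by case: hmetric => /(_ x z) + _ _ _; rewrite leNgt (lt_le_trans dxz).
rewrite -[dball d x e]setCK; apply: open_closedC.
rewrite openE => z /= nxz; apply/hregular; exists e => // w dzw dxw.
apply: nxz; rewrite /dball /=; apply: le_lt_trans (hultra x z w) _.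
by rewrite gt_max [d x w < e]dxw dC.
Qed.

Hypothesis compactC : compact [set: C].

(** In an ultrametric, a point of [v] farthest from the centre of [v] already
    realizes the diameter; compactness of [v] provides one. *)
Lemma vertex_diam_attained (v : vertex d) :
  exists p : C * C, [/\ \val v p.1, \val v p.2 & d p.1 p.2 = diam d (\val v)].
Proof.
have [dge0 d0 dC _] := hmetric.
have /set_mem [x [e [e0 ve]]] := valP v.
have vx : \val v x by rewrite ve /dball /= (d0 x x).2.
have cv : compact (\val v).
  apply: subclosed_compact compactC _ => //.
  by rewrite ve; exact: dball_closed.
have [|z zv zmax] := compact_EVT_max _ cv (continuous_subspaceT (dist_continuous x)).
  by exists x.
exists (x, z); split=> //=; first exact: set_mem.
symmetry; apply: diam_attained => //; first exact: set_mem.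
move=> a b va vb; apply: le_trans (hultra a b x) _.
by rewrite ge_max (dC a x) !zmax //; exact: mem_set.
Qed.

(** The closed ball of positive radius [r] is open, so the points beyond it
    form a compact set.  If it is nonempty, its distance [m] to [x] is attained
    and hence exceeds [r]: the closed ball of radius [r] is the open ball of
    radius [m].  If it is empty, any radius above [r] gives the same set. *)
Lemma closed_ball_vertex (x : C) (r : R) : 0 < r ->
  vertices d [set z | d x z <= r].
Proof.
move=> r0; have [dge0 d0 dC _] := hmetric.
pose K := [set z | r < d x z].
have cK : compact K.
  apply: subclosed_compact compactC _ => //.
  rewrite -[K]setCK; apply: open_closedC.
  rewrite openE => z /= /negP; rewrite -leNgt => dxz.
  apply/hregular; exists r => // w /ltW dzw /=.
  by apply/negP; rewrite -leNgt (le_trans (hultra x w z)) // ge_max dxz.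
have [K0|nK] := pselect (K !=set0).
  have [m /set_mem Km mmin] :=
    compact_EVT_min K0 cK (continuous_subspaceT (dist_continuous x)).
  exists x, (d x m); split; first exact: lt_trans Km.
  apply/seteqP; split=> z; rewrite /dball /=; first by move/le_lt_trans; apply.
  by move=> dzm; rewrite leNgt; apply/negP => /mem_set /mmin; rewrite leNgt dzm.
have le_r z : d x z <= r by rewrite leNgt; apply/negP => rz; apply: nK; exists z.
exists x, (r + 1); split; first exact: addr_gt0.
apply/seteqP; split=> z _ //=.
by rewrite /dball /=; apply: le_lt_trans (le_r z) _; rewrite ltrDl.
Qed.
End UltrametricBalls.

Section Fibres.
Context {R : realType} {V : choiceType}.
Implicit Type psi : V -> 'cV[R[i]]_2.

Definition fibre_sq psi (v : V) : R := \sum_(i < 2) normc (psi v i 0) ^+ 2.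

Lemma fibre_sq_ge0 psi v : 0 <= fibre_sq psi v.
Proof. by apply: sumr_ge0 => i _; exact: sqr_ge0. Qed.

Lemma le_l2norm psi phi :
  (forall v, fibre_sq psi v <= fibre_sq phi v) -> (l2norm psi <= l2norm phi)%E.
Proof.
move=> le; rewrite /l2norm lee_sqrt; first by apply: le_esum => v _; rewrite lee_fin; exact: le.
by apply: esum_ge0 => v _; rewrite lee_fin; exact: fibre_sq_ge0.
Qed.

Lemma l2norm_supp1 psi (v : V) : (forall w, w != v -> psi w = 0) ->
  l2norm psi = (Num.sqrt (fibre_sq psi v))%:E.
Proof.
move=> psi0; rewrite /l2norm.
suff -> : (\esum_(w in [set: V]) (\sum_(i < 2) normc (psi w i 0) ^+ 2)%:E)%E
  = (fibre_sq psi v)%:E by [].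
rewrite -[RHS](@esum_set1 _ _ v (fun w => (fibre_sq psi w)%:E)); last first.
  by rewrite lee_fin fibre_sq_ge0.
rewrite [RHS]esum_mkcond; apply: eq_esum => w _; case: ifPn => // wv.
rewrite /fibre_sq psi0 ?big1 // => [i _|].
  by rewrite mxE normc0 expr0n.
by apply: contra wv => /eqP ->; rewrite inE.
Qed.

Lemma l2_supp1 psi (v : V) : (forall w, w != v -> psi w = 0) -> l2 psi.
Proof. by move=> psi0; rewrite /l2 /= (l2norm_supp1 _ _ psi0) ltry. Qed.

(** Both factors are fibrewise, so every vector met in forming the commutator
    is again supported at [v]: no unboundedness can occur. *)
Lemma commutator_dom_supp1 (M N : V -> 'M[R[i]]_2) psi (v : V) :
  (forall w, w != v -> psi w = 0) ->
  op_dom (commutator (mult_op M) (mult_op N)) psi.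
Proof.
move=> psi0.
by do ![split]; apply: (l2_supp1 _ v) => w wv /=; rewrite psi0 // ?mulmx0.
Qed.
End Fibres.

Section CommutatorNorm.
Context {R : realType} {C : topologicalType} (d : C -> C -> R).
Implicit Types (tau : vertex d -> C * C) (f : C -> R[i]).

(** The difference quotient of [f] along the pair chosen in [v]; it is 0 for a
    vertex of diameter 0, in agreement with the inverse used in [Dirac]. *)
Definition slope tau f (v : vertex d) : R :=
  normc (f (tau v).1 - f (tau v).2) / diam d (\val v).

(** With [M] the diagonal matrix of entries [a] and [b], the commutator of
    [sigma1] and [M] is antidiagonal with entries [b - a] and [a - b], a scalar
    multiple of a unitary matrix. *)
Lemma fibre_sq_commutator tau f psi v :
  fibre_sq (op_fun (commutator (Dirac d) (pi_rep tau f)) psi) v =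
  slope tau f v ^+ 2 * fibre_sq psi v.
Proof.
rewrite /fibre_sq !big_ord_recl !big_ord0 /= !mxE.
rewrite !big_ord_recl !big_ord0 !mxE /= ?big_ord_recl ?big_ord0 ?mxE /=.
rewrite !(mulr1n, mulr0n, mulr0, mulr1, mul0r, addr0, add0r).
rewrite /slope; set c := (diam d _)^-1; set a := f (tau v).1; set b := f (tau v).2.
set s : R[i] := psi v ord0 0; set t : R[i] := psi v _ 0.
have -> : c%:C * (b * t) - a * (c%:C * t) = - (c%:C * (a - b)) * t by ring.
have -> : c%:C * (a * s) - b * (c%:C * s) = c%:C * (a - b) * s by ring.
have normc_c : normc c%:C ^+ 2 = c ^+ 2.
  by rewrite /= expr0n addr0 sqr_sqrtr // sqr_ge0.
rewrite !normcM normcN normcM !exprMn normc_c; ring.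
Qed.

Lemma opnorm_commutator_le1 tau f : (forall v, `|slope tau f v| <= 1) ->
  (opnorm (commutator (Dirac d) (pi_rep tau f)) <= 1)%E.
Proof.
move=> slope1; apply: ge_ereal_sup => _ [psi [_ psi1] <-].
apply: le_trans psi1; apply: le_l2norm => v.
rewrite fibre_sq_commutator ler_piMl ?fibre_sq_ge0 //.
by rewrite -real_normK ?num_real // expr_le1.
Qed.

(** The unit vector supported at [v] is a witness. *)
Lemma le_opnorm_commutator tau f (v : vertex d) :
  (`|slope tau f v|%:E <= opnorm (commutator (Dirac d) (pi_rep tau f)))%E.
Proof.
pose psi (w : vertex d) : 'cV[R[i]]_2 := if w == v then delta_mx 0 0 else 0.
have psi0 w : w != v -> psi w = 0 by rewrite /psi => /negbTE ->.
have psi_sq : fibre_sq psi v = 1.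
  rewrite /fibre_sq /psi eqxx !big_ord_recl big_ord0 !mxE /=.
  by rewrite expr1n expr0n !addr0 sqrtr0 sqrtr1 expr1n expr0n addr0.
apply: ereal_sup_ubound; exists psi.
  split; first exact: (commutator_dom_supp1 _ _ _ v).
  by rewrite /= (l2norm_supp1 _ _ psi0) psi_sq sqrtr1.
rewrite (l2norm_supp1 _ v) => [|w wv].
  by rewrite fibre_sq_commutator psi_sq mulr1 sqrtr_sqr.
by rewrite /= psi0 // !mulmx0 subr0.
Qed.
End CommutatorNorm.

Section ChoiceFunctions.
Context {R : realType} {C : topologicalType} (d : C -> C -> R).
Hypotheses (hmetric : is_metric d) (hregular : regular d).
Hypotheses (hultra : ultrametric d) (compactC : compact [set: C]).

Lemma choice_function_through (v : vertex d) (p q : C) :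
  \val v p -> \val v q -> d p q = diam d (\val v) ->
  exists2 tau, choice_functions d tau & tau v = (p, q).
Proof.
move=> vp vq dpq.
have [tau tauP] := choice (vertex_diam_attained d hmetric hregular hultra compactC).
exists (fun w => if w == v then (p, q) else tau w); last by rewrite eqxx.
by move=> w /=; case: eqVneq => [->|_] //; exact: tauP.
Qed.

End ChoiceFunctions.

Lemma slope_dist_le1 {R : realType} {C : topologicalType} (d : C -> C -> R)
    (x : C) tau : is_metric d -> choice_functions d tau ->
  forall v, `|slope d tau (fun z => (d x z)%:C) v| <= 1.
Proof.
move=> hmetric tauP v; have [_ _ diamE] := tauP v.
have [dge0 d0 dC dT] := hmetric.
rewrite /slope -diamE; set p := (tau v).1; set q := (tau v).2.
rewrite normrM normfV [X in _ / X]ger0_norm //.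
have [->|dpq] := eqVneq (d p q) 0; first by rewrite invr0 mulr0.
rewrite ler_pdivrMr ?lt0r ?dpq ?dge0 // mul1r.
rewrite -rmorphB /= expr0n addr0 sqrtr_sqr normr_id.
exact: dist_lipschitz.
Qed.

Theorem theorem1 (R : realType) (C : topologicalType) (d : C -> C -> R)
    (hC : cantor_set R C) (hmetric : is_metric d) (hregular : regular d)
    (hultra : ultrametric d) :
  forall x y : C, spectral_dist d x y = (d x y)%:E.
Proof.
have [_ _ compactC _ _] := hC.
have [dge0 d0 dC dT] := hmetric.
move=> x y; apply/le_anti/andP; split.
  apply: ge_ereal_sup => _ [f [_ f1] <-]; rewrite lee_fin.
  have [<-|/eqP xy] := eqVneq x y; first by rewrite subrr normc0 dge0.
  have dxy : 0 < d x y.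
    by rewrite lt0r dge0 andbT; apply/eqP => /d0.
  pose v : vertex d :=
    SigSub (mem_set (closed_ball_vertex d hmetric hregular hultra compactC x (d x y) dxy)).
  have vx : \val v x by rewrite /= (d0 x x).2.
  have vy : \val v y by rewrite /=.
  have diamv : diam d (\val v) = d x y.
    apply: diam_attained => // a b va vb.
    by apply: le_trans (hultra a b x) _; rewrite ge_max dC; apply/andP.
  (* evaluating the bound at this [tau] and [v] isolates [f x - f y] *)
  have [tau tauP tauv] := choice_function_through d hmetric hregular hultra
    compactC v x y vx vy (esym diamv).
  have : (`|slope d tau f v|%:E <= 1)%E.
    apply: le_trans (le_opnorm_commutator d tau f v) _; apply: le_trans f1.
    by apply: ereal_sup_ubound; exists tau.
  rewrite /slope tauv diamv lee_fin /=; move/(le_trans (ler_norm _)).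
  by rewrite ler_pdivrMr // mul1r.
pose f (z : C) : R[i] := (d x z)%:C.
have normc_f a b : normc (f a - f b) = `|d x a - d x b|.
  by rewrite /f -rmorphB /= expr0n addr0 sqrtr_sqr.
apply: ereal_sup_ubound; exists f; last first.
  by rewrite normc_f (d0 x x).2 // sub0r normrN ger0_norm.
split.
  exists 1 => a b; rewrite normc_f mul1r; exact: dist_lipschitz.
apply: ge_ereal_sup => _ [tau tauP <-].
by apply: opnorm_commutator_le1; exact: slope_dist_le1.
Qed.
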